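(* Let $(S,\tau)$ be a topological (respectively, topological inverse) semigroup which is an $\mathsf{OIP}$-semigroup. Then there exists a topological $\mathbb{Z}$-Bruck extension $(\mathscr{B}(S,\mathbb{Z}),\tau_{\mathbf{BR}})$ of $(S,\tau)$ in the class of topological (respectively, topological inverse) semigroups such that the topology $\tau_{\mathbf{BR}}$ is strictly coarser than the direct sum topology $\tau_{\mathbf{BR}}^{\mathbf{ds}}$ on $\mathscr{B}(S,\mathbb{Z})$.
   Context: All topological spaces are Hausdorff. A topological semigroup is a (Hausdorff) topological space with a jointly continuous semigroup operation; a topological inverse semigroup is an inverse semigroup that is a topological semigroup with continuous inversion. Ideals are two-sided and nonempty. Convention: $S$ always has a unit $1_S$; a semigroup without unit is replaced by the monoid $S^1$ obtained by adjoining an isolated unit, so $S=S^1$. A semitopological semigroup $S$ (Hausdorff space with separately continuous operation) is an $\mathsf{OIP}$-semigroup (has the open ideal property) if there is a family $\mathscr{I}=\{I_\alpha\}_{\alpha\in\mathcal{A}}$ of open ideals in $S$ such that for every $x\in S$ there exist $I_\alpha\in\mathscr{I}$ and an open neighbourhood $U(x)$ of $x$ in $S$ with $U(x)\cap I_\alpha=\varnothing$. The $\mathbb{Z}$-Bruck extension $\mathscr{B}(S,\mathbb{Z})$ is the set $\mathbb{Z}\times S\times\mathbb{Z}$ with the semigroup operation $$(i,s,j)\cdot(m,t,n)=\begin{cases}(i-j+m,t,n), & j<m,\\ (i,s\cdot t,n), & j=m,\\ (i,s,n-m+j), & j>m.\end{cases}$$ For $m,n\in\mathbb{Z}$ put $S_{m,n}=\{(m,s,n)\colon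 s\in S\}$. The direct sum topology $\tau_{\mathbf{BR}}^{\mathbf{ds}}$ is the product topology on $\mathbb{Z}\times S\times\mathbb{Z}$ with $\mathbb{Z}$ discrete, i.e. the topology with base $\{\{i\}\times U\times\{j\}\colon U\in\tau,\ i,j\in\mathbb{Z}\}$. A topological $\mathbb{Z}$-Bruck extension of $(S,\tau)$ in a class $\mathfrak{S}$ of semitopological semigroups (with $(S,\tau)\in\mathfrak{S}$) is a semigroup $(\mathscr{B}(S,\mathbb{Z}),\tau_{\mathbf{BR}})\in\mathfrak{S}$ such that, for some $m\in\mathbb{Z}$, the restriction of $\tau_{\mathbf{BR}}$ to $S_{m,m}$ coincides with $\tau$ under the identification $(m,s,m)\leftrightarrow s$. *)

(* Defs.v *)
From HB Require Import structures.
From mathcomp Require Import all_boot all_order all_algebra.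
From mathcomp Require Import all_classical all_reals all_analysis.
From mathcomp Require Import zify.

Set Implicit Arguments.
Unset Strict Implicit.
Unset Printing Implicit Defensive.

Import Order.TTheory GRing.Theory.
Local Open Scope classical_set_scope.
Local Open Scope ring_scope.

(* The library has no structure combining a topology with a multiplicative
   semigroup, so a semigroup with a topology is a [topologicalType] [T] together
   with an associative operation [mul : SemiGroup.law T], and a class of
   such objects is a predicate on these pairs. *)
Definition semigroup_class : Type :=
  forall T : topologicalType, SemiGroup.law T -> Prop.

Definition semitopological_semigroup : semigroup_class := fun T mul =>
  [/\ hausdorff_space T,
      forall a, continuous (fun x => mul a x)
    & forall a, continuous (fun x => mul x a)].

Definition topological_semigroup : semigroup_class := fun T mul =>
  hausdorff_space T /\ continuous (fun p : T * T => mul p.1 p.2).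

Definition semigroup_inverse (T : Type) (mul : SemiGroup.law T) (x y : T) :=
  mul (mul x y) x = x /\ mul (mul y x) y = y.

Definition inverse_semigroup (T : Type) (mul : SemiGroup.law T) :=
  forall x, exists! y, semigroup_inverse mul x y.

Definition topological_inverse_semigroup : semigroup_class := fun T mul =>
  [/\ topological_semigroup mul, inverse_semigroup mul
    & exists2 inv : T -> T,
        forall x, semigroup_inverse mul x (inv x) & continuous inv].

Definition semigroup_ideal (T : Type) (mul : SemiGroup.law T) (I : set T) :=
  I !=set0 /\ forall s a, I a -> I (mul s a) /\ I (mul a s).

Definition OIP_semigroup : semigroup_class := fun T mul =>
  semitopological_semigroup mul /\
  exists F : set (set T),
    (forall I, F I -> open I /\ semigroup_ideal mul I) /\
    forall x, exists I U, [/\ F I, open_nbhs x U & U `&` I = set0].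

Definition bruck (S : Type) : Type := (int * S * int)%type.

Definition bruck_mul (S : Type) (mul : S -> S -> S) (x y : bruck S) : bruck S :=
  let: (i, s, j) := x in
  let: (m, t, n) := y in
  if j < m then (i - j + m, t, n)
  else if j == m then (i, mul s t, n)
  else (i, s, n - m + j).

Lemma bruck_mulA (S : Type) (mul : SemiGroup.law S) :
  associative (bruck_mul mul).
Proof.
move=> [[i s] j] [[m t] n] [[p u] q]; rewrite /bruck_mul.
by repeat (case: ltgtP => /= ?); try lia;
  congr (_, _, _); first [lia | exact: SemiGroup.opA].
Qed.

HB.instance Definition _ (S : Type) (mul : SemiGroup.law S) :=
  SemiGroup.isLaw.Build (bruck S) (bruck_mul mul) (bruck_mulA mul).

(* [Topological.axioms_ X] is the record of topological structures on the
   carrier [X]; [with_topology tau] is [X] endowed with [tau]. *)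
Definition topology_on (X : Type) : Type := Topological.axioms_ X.
Definition with_topology (X : Type) (tau : topology_on X) : topologicalType :=
  Topological.Pack tau.

Definition strictly_coarser (X : Type) (tau sigma : topology_on X) :=
  (forall A : set X, open (A : set (with_topology tau)) ->
                     open (A : set (with_topology sigma))) /\
  exists A : set X, open (A : set (with_topology sigma)) /\
                  ~ open (A : set (with_topology tau)).

Definition bruck_ds (S : topologicalType) : topology_on (bruck S) :=
  Topological.class (discrete_topology int * S * discrete_topology int)%type.

Definition bruck_block (S : Type) (m n : int) : set (bruck S) :=
  [set (m, s, n) | s in setT].

(* [tau] makes B(S, Z) a topological Z-Bruck extension of [S] in the class [C];
   the last clause says that the subspace topology on the block (m, m) is
   the topology of [S] transported along s |-> (m, s, m). *)
Definition topological_bruck_extension (C : semigroup_class)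
    (S : topologicalType) (mul : SemiGroup.law S) (tau : topology_on (bruck S)) :=
  [/\ C S mul,
      C (with_topology tau) (bruck_mul mul)
    & exists m : int, forall U : set S,
        open U <->
        exists2 V : set (bruck S), open (V : set (with_topology tau))
          & V `&` bruck_block m m = [set (m, s, m) | s in U]].

(* Main.v *)
Require Import Defs.
From HB Require Import structures.
From mathcomp Require Import all_boot all_order all_algebra.
From mathcomp Require Import all_classical all_reals all_analysis.
From mathcomp Require Import zify.

Set Implicit Arguments.
Unset Strict Implicit.
Unset Printing Implicit Defensive.

Import Order.TTheory GRing.Theory.
Local Open Scope classical_set_scope.
Local Open Scope ring_scope.

(** The topology is obtained from the direct sum topology by adding one kind of
    convergence: along each diagonal, the filter generated by the open
    ideals of S, placed in the block (i - 1, j - 1), converges to the unit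
    (i, e, j) of the next block. This is compatible with the product because an
    element (i - 1, a, j - 1) acts on a block with index at least j exactly as
    (i, e, j) does, whatever a is:

      (i - 1, a, j - 1) (j, t, n) = (i, t, n) = (i, e, j) (j, t, n),

    whereas when it meets a block with index at most j - 1 the product has its
    middle coordinate in the ideal containing a, and so stays close to the
    unit to which the product has to converge
    ([oip_mul_continuous]). Inversion is continuous since ideals of an inverse
    semigroup are closed under inversion ([oip_inv_continuous]).

    The open ideal property serves twice. It gives an open ideal that does not
    contain e, hence basic neighbourhoods of a point that meet at most two blocks
    ([oip_nbhsP]); and it separates a point of the block (i - 1, j - 1) from
    the ideals that accumulate at (i, e, j), which is the only nontrivial case
    of the Hausdorff property ([oip_hausdorff]). Each block keeps the
    topology of S, but no block is open, because ideals are nonempty: so the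
    topology is strictly coarser than the direct sum topology. *)

(** * Open ideals *)

Section OpenIdeals.
Context {S : topologicalType} {e : S} (mul : Monoid.law e).

Definition open_ideal (I : set S) := open I /\ semigroup_ideal mul I.

Lemma open_idealT : open_ideal setT.
Proof. by split; [exact: openT | split=> //; exists e]. Qed.

(** Nonemptiness is the point: the product of a member of [I] and a member of
    [J] lies in both ideals. *)
Lemma open_idealI I J : open_ideal I -> open_ideal J -> open_ideal (I `&` J).
Proof.
move=> [oI [[a Ia] idI]] [oJ [[b Jb] idJ]]; split; first exact: openI.
split; first by exists (mul a b); split; [case: (idI b a Ia) | case: (idJ a b Jb)].
by move=> s c [/(idI s)[? ?] /(idJ s)[? ?]].
Qed.

Lemma open_ideal_unit I : open_ideal I -> I e -> I = setT.
Proof.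
move=> [_ [_ idI]] Ie; apply/seteqP; split=> // x _.
by have : I (mul x e) := (idI x e Ie).1; rewrite Monoid.mulm1.
Qed.

(** The family in the open ideal property may be replaced by that of all open
    ideals avoiding the unit: an ideal missing a neighbourhood of a point is
    not the whole semigroup. *)
Lemma OIP_separation : OIP_semigroup mul -> forall x, exists I U,
  [/\ open_ideal I, ~ I e, open_nbhs x U & U `&` I = set0].
Proof.
move=> [_ [F [FI Fx]]] x; have [I [U [/FI II xU UI0]]] := Fx x.
exists I, U; split=> // /(open_ideal_unit II) IT.
have : (U `&` I) x by rewrite IT; split=> //; case: xU.
by rewrite UI0.
Qed.

Lemma open_ideal_inv (inv : S -> S) I :
  (forall x, semigroup_inverse mul x (inv x)) ->
  open_ideal I -> forall a, I a -> I (inv a).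
Proof.
move=> invP [_ [_ idI]] a Ia; have [_ <-] := invP a.
by apply: (idI _ _ _).2; apply: (idI _ _ _).1.
Qed.

End OpenIdeals.

(** * The topology on the extension *)

(** A copy of [bruck S] that records the monoid law, since the topology depends
    on the ideals. *)
Definition oip_bruck (S : topologicalType) (e : S) (mul : Monoid.law e) : Type :=
  bruck S.

HB.instance Definition _ (S : topologicalType) (e : S) (mul : Monoid.law e) :=
  Choice.on (oip_bruck mul).

Section Topology.
Context {S : topologicalType} {e : S} (mul : Monoid.law e).
Implicit Types (A B : set (bruck S)) (p : bruck S).

Definition bruck_section A (i j : int) : set S := [set s | A (i, s, j)].

(** The second clause makes the filter generated by the open ideals of the
    block (i - 1, j - 1) converge to the unit of the block (i, j). *)
Definition bruck_open A := forall i j,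
  open (bruck_section A i j) /\
  (A (i, e, j) ->
   exists2 I, open_ideal mul I & I `<=` bruck_section A (i - 1) (j - 1)).

Lemma bruck_openT : bruck_open setT.
Proof.
by move=> i j; split=> [|_]; [exact: openT | exists setT => //; exact: open_idealT].
Qed.

Lemma bruck_openI : setI_closed bruck_open.
Proof.
move=> A B oA oB i j; have [oAs IA] := oA i j; have [oBs IB] := oB i j.
split=> [|[/IA[I II AI] /IB[J IJ BJ]]]; first exact: openI.
by exists (I `&` J); [exact: open_idealI | move=> s [/AI ? /BJ ?]].
Qed.

Lemma bruck_open_bigU (T : Type) (f : T -> set (bruck S)) :
  (forall t, bruck_open (f t)) -> bruck_open (\bigcup_t f t).
Proof.
move=> of_ i j; split=> [|[t _ ft]].
  suff -> : bruck_section (\bigcup_t f t) i j =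
            \bigcup_t bruck_section (f t) i j.
    by apply: bigcup_open => t _; case: (of_ t i j).
  by apply/seteqP; split=> s [t _ fts]; exists t.
have [_ /(_ ft)[I II If]] := of_ t i j.
by exists I => // s /If; exists t.
Qed.

HB.instance Definition _ := @isOpenTopological.Build (oip_bruck mul)
  bruck_open bruck_openT bruck_openI bruck_open_bigU.

Definition oip_topology : topology_on (bruck S) :=
  Topological.class (oip_bruck mul).

Local Notation TB := (oip_bruck mul).

(** The point [p] enters only through its block. The ideal is attached as soon as
    [U] contains the unit, even if [p] itself is not the unit of its block:
    this makes the set open with no need to shrink [U]. *)
Definition bruck_basic p (U I : set S) : set (bruck S) := fun x =>
  let: (i, s, j) := p in let: (m, t, n) := x in
  [/\ m = i, n = j & U t] \/ [/\ U e, m = i - 1, n = j - 1 & I t].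

(** If [I] contained [e], openness would require a further ideal in the block
    (i - 2, j - 2), and so on down the diagonal. *)
Lemma bruck_basic_open p U I : open U -> open_ideal mul I -> ~ I e ->
  open (bruck_basic p U I : set TB).
Proof.
case: p => [[i s] j] oU II nIe.
suff : bruck_open (bruck_basic (i, s, j) U I) by [].
move=> m n; split.
  rewrite openE => t /= [[-> -> Ut]|[Ue -> -> It]]; rewrite /interior.
    by apply: filterS (open_nbhs_nbhs (conj oU Ut)) => u Uu; left.
  by apply: filterS (open_nbhs_nbhs (conj II.1 It)) => u Iu; right.
by case=> [[-> -> Ue]|[_ _ _ /nIe//]]; exists I => // t It; right.
Qed.

Hypothesis proper_ideal : exists2 I, open_ideal mul I & ~ I e.

Lemma oip_nbhsP p B : nbhs (p : TB) B <-> exists U I,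
  [/\ open_nbhs p.1.2 U, open_ideal mul I, ~ I e & bruck_basic p U I `<=` B].
Proof.
case: p => [[i s] j] /=; split.
  rewrite nbhsE => -[A [oA Ap] AB].
  have {}oA : bruck_open A by [].
  have [I0 II0 nI0e] := proper_ideal; have [oAs AI] := oA i j.
  have [Ae|nAe] := pselect (A (i, e, j)).
    have [I II IA] := AI Ae.
    exists (bruck_section A i j), (I `&` I0); split=> //.
    - exact: open_idealI.
    - by case.
    by move=> [[m t] n] [[-> -> At]|[_ -> -> [/IA At _]]]; exact: AB.
  exists (bruck_section A i j), I0; split=> //.
  by move=> [[m t] n] [[-> -> At]|[/nAe//]]; exact: AB.
move=> [U [I [[oU Us] II nIe UB]]].
apply: filterS UB _; apply: open_nbhs_nbhs; split; first exact: bruck_basic_open.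
by left.
Qed.

(** With one and the same ideal [I] for both factors, only the middle coordinates
    remain to be controlled: by [U] itself when the blocks do not interact,
    and by continuity of the product of [S] when they do. *)
Lemma oip_mul_continuous : continuous (fun x : S * S => mul x.1 x.2) ->
  continuous (fun x : TB * TB => bruck_mul mul x.1 x.2 : TB).
Proof.
move=> cmul [[[i s] j] [[m t] n]] B /oip_nbhsP[U [I [oUst II nIe UB]]].
suff [V [W [sV tW VW]]] : exists V W, [/\ open_nbhs s V, open_nbhs t W &
    forall x y, bruck_basic (i, s, j) V I x -> bruck_basic (m, t, n) W I y ->
      B (bruck_mul mul x y)].
  exists (bruck_basic (i, s, j) V I, bruck_basic (m, t, n) W I) => /=.
    by split; apply/oip_nbhsP; [exists V, I | exists W, I]; split.
  by move=> [x y] [/= Vx Wy]; exact: VW.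
have ImulL u a : I a -> I (mul u a) by move=> Ia; apply: (II.2.2 u a Ia).1.
have ImulR u a : I a -> I (mul a u) by move=> Ia; apply: (II.2.2 u a Ia).2.
move: oUst UB; rewrite /bruck_mul /=.
case: (ltgtP j m) => [jm|mj|jm] /= oUst UB.
- exists setT, U; split=> //; first exact: open_nbhsT.
  move=> [[i' a] j'] [[m' b] n'] /= [[-> -> _]|[_ -> -> Ia]]
    [[-> -> Ub]|[Ue -> -> Ib]]; apply: UB => /=;
  repeat (case: ltgtP => /= ?); try lia;
  by [left; split=> //; lia | right; split=> //; try lia; exact: ImulL].
- exists U, setT; split=> //; first exact: open_nbhsT.
  move=> [[i' a] j'] [[m' b] n'] /= [[-> -> Ua]|[Ue -> -> Ia]]
    [[-> -> _]|[_ -> -> Ib]]; apply: UB => /=;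
  repeat (case: ltgtP => /= ?); try lia;
  by [left; split=> //; lia | right; split=> //; try lia; exact: ImulR].
(* A point of the ideal acts on the other factor as [e], which belongs to [V] or
   to [W] whenever such a point is present; this is why [VWU] also covers the
   mixed cases below. *)
have [V [W [sV tW VWU]]] : exists V W, [/\ open_nbhs s V, open_nbhs t W &
    forall a b, V a -> W b -> U (mul a b)].
  have [[V W] /= [sV tW] VWU] := cmul (s, t) U (open_nbhs_nbhs oUst).
  move: sV tW; rewrite !nbhsE => -[V' sV' VV'] [W' tW' WW'].
  exists V', W'; split=> // a b /VV' Va /WW' Wb; exact: (VWU (a, b)).
exists V, W; split=> //.
have me1 a : mul e a = a := Monoid.mul1m mul a.
have m1e a : mul a e = a := Monoid.mulm1 mul a.
move=> [[i' a] j'] [[m' b] n'] /= [[-> -> Va]|[Ve -> -> Ia]]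
  [[-> -> Wb]|[We -> -> Ib]]; apply: UB => /=;
  repeat (case: ltgtP => /= ?); try lia.
- by left; split=> //; exact: VWU.
- by left; split=> //; try lia; rewrite -(m1e a); exact: VWU.
- by left; split=> //; try lia; rewrite -(me1 b); exact: VWU.
- right; split=> //; last exact: ImulR.
  by rewrite -(m1e e); exact: VWU.
Qed.

(** Distinct points of a block are separated in [S]. For distinct blocks the
    danger is that the ideal attached to one point meets the neighbourhood
    of the other; one common ideal missing neighbourhoods of both middle
    coordinates prevents it. *)
Lemma oip_hausdorff : hausdorff_space S ->
  (forall s : S, exists I U,
    [/\ open_ideal mul I, ~ I e, open_nbhs s U & U `&` I = set0]) ->
  hausdorff_space TB.
Proof.
move=> hS sepS; rewrite open_hausdorff => -[[i s] j] [[m t] n] neq.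
suff [U [V [K [[oU Us] [oV Vt] KK nKe dis]]]] : exists U V K,
    [/\ open_nbhs s U, open_nbhs t V, open_ideal mul K, ~ K e &
     forall x, bruck_basic (i, s, j) U K x ->
       bruck_basic (m, t, n) V K x -> False].
  exists (bruck_basic (i, s, j) U K, bruck_basic (m, t, n) V K) => /=.
    by split; rewrite inE /=; left.
  split; [exact: bruck_basic_open | exact: bruck_basic_open |].
  by apply/eqP/seteqP; split=> // x [/dis].
have [I [U [II nIe sU UI]]] := sepS s; have [J [V [JJ nJe tV VJ]]] := sepS t.
have [[im jn]|ijmn] := pselect (i = m /\ j = n).
  subst m n; have st : s != t by apply: contra_neq neq => ->.
  move: hS; rewrite open_hausdorff => /(_ s t st)[[U' V'] /=].
  rewrite !inE => -[U's V't] [oU' oV' UV0].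
  exists U', V', I; split=> //.
  have UV a : U' a -> V' a -> False.
    by move=> Ua Va; have : (U' `&` V') a by []; rewrite UV0.
  move=> [[i' a] j'] /= [[-> -> Ua]|[Ue -> -> Ia]]
    [[? ? Va]|[Ve ? ? Ja]]; try lia; [exact: UV Ua Va | exact: UV Ue Ve].
exists U, V, (I `&` J); split=> //; [exact: open_idealI | by case |].
move=> [[i' a] j'] /= [[-> -> Ua]|[Ue -> -> [Ia Ja]]]
    [[? ? Va]|[Ve ? ? [Ia' Ja']]].
- by apply: ijmn.
- by have : (U `&` I) a by []; rewrite UI.
- by have : (V `&` J) a by []; rewrite VJ.
- by apply: ijmn; lia.
Qed.

Definition bruck_inv (inv : S -> S) p : bruck S :=
  let: (i, s, j) := p in (j, inv s, i).

Lemma oip_inv_continuous (inv : S -> S) :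
  (forall x, semigroup_inverse mul x (inv x)) -> inverse_semigroup mul ->
  continuous inv -> continuous (bruck_inv inv : TB -> TB).
Proof.
move=> invP uniqP cinv [[i s] j] B /oip_nbhsP[U [I [sU II nIe UB]]].
have inve : inv e = e.
  have [y [_ yP]] := uniqP e.
  rewrite -(yP _ (invP e)); apply: yP.
  have eee : mul (mul e e) e = e by rewrite !Monoid.mul1m.
  by split.
apply/oip_nbhsP; exists (inv @^-1` U), I; split=> //.
  case: sU => oU Us; split=> //.
  by apply: open_comp => // x _; exact: cinv.
move=> [[m a] n] /= [[-> -> Ua]|[]]; first by apply: UB; left.
rewrite /= inve => Ue -> -> Ia; apply: UB; right; split=> //.
exact: open_ideal_inv invP II _ Ia.
Qed.

End Topology.

(** * Algebra of the extension *)

Lemma bruck_inverseP (S : Type) (mul : SemiGroup.law S) i s j m t n :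
  semigroup_inverse (bruck_mul mul) (i, s, j) (m, t, n) <->
  [/\ m = j, n = i & semigroup_inverse mul s t].
Proof.
rewrite /semigroup_inverse /=; split.
  rewrite /bruck_mul; case.
  repeat (case: ltgtP => /= ?; try lia); case=> *; subst; try lia;
  match goal with H : (_, _, _) = _ |- _ => case: H => * | _ => idtac end;
  try lia; by split=> //; lia.
case=> -> -> [sts tst].
by rewrite /bruck_mul; repeat (rewrite !ltxx ?eqxx /=); rewrite sts tst.
Qed.

Lemma bruck_inverse_semigroup (S : Type) (mul : SemiGroup.law S) :
  inverse_semigroup mul -> inverse_semigroup (bruck_mul mul).
Proof.
move=> uniqP [[i s] j]; have [t [st tP]] := uniqP s.
exists (j, t, i); split; first exact/bruck_inverseP.
by move=> [[m u] n] /bruck_inverseP[-> -> /tP ->].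
Qed.

(** * Comparison with the direct sum topology and with S *)

Lemma bruck_ds_open (S : topologicalType) (A : set (bruck S)) :
  open (A : set (with_topology (bruck_ds S))) <->
  forall i j, open (bruck_section A i j).
Proof.
split=> [oA i j|oA].
  rewrite openE => s As; rewrite /interior.
  have : nbhs ((i, s, j) : discrete_topology int * S * discrete_topology int) A.
    exact: open_nbhs_nbhs (conj oA As).
  case=> -[P Q] [/= [[P1 P2] [P1i P2s] sP] Qj] sA.
  apply: filterS P2s => u P2u; apply: sA; split; last exact: nbhs_singleton.
  by apply: sP; split=> //; exact: nbhs_singleton.
rewrite openE => -[[i s] j] Aisj; rewrite /interior.
exists ([set i] `*` bruck_section A i j, [set j]) => /=.
  split; last exact: discrete_set1.
  exists ([set i], bruck_section A i j) => //=.
  split; first exact: discrete_set1.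
  exact: open_nbhs_nbhs.
by move=> [[m t] n] /= [[-> ?] ->].
Qed.

Lemma oip_strictly_coarser (S : topologicalType) (e : S) (mul : Monoid.law e) :
  strictly_coarser (oip_topology mul) (bruck_ds S).
Proof.
split=> [A oA|].
  have {}oA : bruck_open mul A by [].
  by apply/bruck_ds_open => i j; case: (oA i j).
(* A block contains its unit, but meets no ideal of the adjacent block. *)
exists (bruck_block 0 0); split.
  apply/bruck_ds_open => i j; rewrite openE => s [t _ [<- _ <-]].
  by apply: filterS filterT => u _; exists u.
move=> oA; have {}oA : bruck_open mul (bruck_block 0 0) by [].
have [_ [|I [_ [[a Ia] _]] IA]] := oA 0 0; first by exists e.
by have [b _ []] := IA a Ia.
Qed.

(** An open set of the block (m, m) becomes open in the extension after adding all
    blocks (i, j) with i < m, which absorb the ideals of the convergence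
    condition. *)
Lemma oip_block_topology (S : topologicalType) (e : S) (mul : Monoid.law e)
    (m : int) (U : set S) :
  open U <-> exists2 V : set (bruck S),
    open (V : set (with_topology (oip_topology mul)))
  & V `&` bruck_block m m = [set (m, s, m) | s in U].
Proof.
split=> [oU|[V oV VU]].
  exists [set x | x.1.1 < m \/ [/\ x.1.1 = m, x.2 = m & U x.1.2]].
    suff : bruck_open mul
      [set x | x.1.1 < m \/ [/\ x.1.1 = m, x.2 = m & U x.1.2]] by [].
    move=> i j; split.
      rewrite openE => s /= [im|[im jm Us]]; rewrite /interior.
        by apply: filterS filterT => u _; left.
      by apply: filterS (open_nbhs_nbhs (conj oU Us)) => u Uu; right.
    move=> im; exists setT; first exact: open_idealT.
    by move=> s _; left => /=; case: im => /= [|[]]; lia.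
  apply/seteqP; split=> [[[i s] j] [Vx [t _ [mi ts mj]]]|_ [s Us <-]].
    subst i s j; case: Vx => /= [?|[_ _ Ut]]; [lia | by exists t].
  by split; [right | exists s].
have {}oV : bruck_open mul V by [].
suff -> : U = bruck_section V m m by case: (oV m m).
apply/seteqP; split=> s Us.
  have : (V `&` bruck_block m m) (m, s, m) by rewrite VU; exists s.
  by case.
have : (V `&` bruck_block m m) (m, s, m) by split=> //; exists s.
by rewrite VU => -[t Ut [<-]].
Qed.

(** * The extension in both classes *)

Section Extension.
Context {S : topologicalType} {e : S} (mul : Monoid.law e).
Hypothesis hOIP : OIP_semigroup mul.

Lemma OIP_proper_ideal : exists2 I, open_ideal mul I & ~ I e.
Proof. by have [I [_ [II nIe _ _]]] := OIP_separation hOIP e; exists I. Qed.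

Lemma oip_topological_semigroup : topological_semigroup mul ->
  @topological_semigroup (with_topology (oip_topology mul)) (bruck_mul mul).
Proof.
move=> [hS cmul]; split.
  exact: (oip_hausdorff hS (OIP_separation hOIP)).
exact: (oip_mul_continuous OIP_proper_ideal cmul).
Qed.

Lemma oip_topological_inverse_semigroup : topological_inverse_semigroup mul ->
  @topological_inverse_semigroup (with_topology (oip_topology mul))
    (bruck_mul mul).
Proof.
move=> [topS uniqP [inv invP cinv]]; split.
- exact: oip_topological_semigroup.
- exact: bruck_inverse_semigroup.
exists (bruck_inv inv).
  by move=> [[i s] j]; exact/bruck_inverseP.
exact: (oip_inv_continuous OIP_proper_ideal invP uniqP cinv).
Qed.

End Extension.

Theorem corollary2p14 (S : topologicalType) (e : S) (mul : Monoid.law e)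
    (hOIP : OIP_semigroup mul) :
  (topological_semigroup mul ->
     exists tau : topology_on (bruck S),
       topological_bruck_extension topological_semigroup mul tau /\
       strictly_coarser tau (bruck_ds S)) /\
  (topological_inverse_semigroup mul ->
     exists tau : topology_on (bruck S),
       topological_bruck_extension topological_inverse_semigroup mul tau /\
       strictly_coarser tau (bruck_ds S)).
Proof.
split=> topS; exists (oip_topology mul); (split; last exact: oip_strictly_coarser);
  (split=> //; last by exists 0 => U; exact: oip_block_topology).
  exact: oip_topological_semigroup.
exact: oip_topological_inverse_semigroup.
Qed.
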